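(* Let $f:\{-1,1\}^n\to\{-1,1\}$ be a boolean function, let $V_1\subset[n]$, $k\in[n]\setminus V_1$, $\epsilon\in(0,\tfrac12)$, and put $V_2=V_1\cup\{k\}$. Then $$M_{V_2,\epsilon}(f)-M_{V_1,\epsilon}(f)\geq -I_k(f)\Big(3\epsilon+2\epsilon^2+\big(\tfrac{I_k(f)}{4}\big)^{-\epsilon}-1\Big).$$
   Context: For $V\subseteq[n]$ and $x\in\{-1,1\}^n$, the restricted function $f_{V^c\to x}:\{-1,1\}^V\to\{-1,1\}$ is $f_{V^c\to x}(y)=f(z)$ with $z_i=y_i$ for $i\in V$ and $z_i=x_i$ for $i\notin V$. For $u:\{-1,1\}^V\to\mathbb{R}$ and $S\subseteq V$, $\hat u(S)=2^{-|V|}\sum_y u(y)\prod_{i\in S}y_i$. For $\epsilon\in[0,\tfrac12)$, $M_{V,\epsilon}(f)=\mathbb{E}_{x}\sum_{S\subseteq V}|\widehat{f_{V^c\to x}}(S)|^{2(1+\epsilon)}$, with $x$ uniform on $\{-1,1\}^n$. The influence is $I_k(f)=\mathbb{P}_x(f(x)\neq f(\mu_k(x)))$, $\mu_k(x)$ being $x$ with the $k$-th coordinate flipped. If $I_k(f)=0$ the term $I_k(f)(I_k(f)/4)^{-\epsilon}$ is interpreted as $0$. *)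

(* Defs.v *)
From mathcomp Require Import all_boot all_order all_algebra.
From mathcomp Require Import reals exp.

Set Implicit Arguments.
Unset Strict Implicit.
Unset Printing Implicit Defensive.

Import Order.TTheory GRing.Theory Num.Theory.
Local Open Scope ring_scope.

(* {-1,1}^T.  The set {-1,1} is encoded by bool: b stands for (-1)^b, so that
   true is -1, false is 1, and changing the sign is boolean negation. *)
Definition cube (T : finType) := {ffun T -> bool}.

Definition sgn_val (R : realType) (b : bool) : R := (-1) ^+ b.

Definition expectation (R : realType) (X : finType) (g : X -> R) : R :=
  (\sum_(x : X) g x) / #|X|%:R.

Definition prob (R : realType) (X : finType) (A : {set X}) : R :=
  #|A|%:R / #|X|%:R.

Definition fourier (R : realType) (T : finType) (u : cube T -> R)
    (S : {set T}) : R :=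
  2 ^- #|T| * \sum_(y : cube T) u y * \prod_(i in S) sgn_val R (y i).

(* The subset V of the coordinates seen as a type: {-1,1}^V is cube (coords V),
   and the subsets S of V are the elements of {set coords V}. *)
Definition coords (n : nat) (V : {set 'I_n}) : finType := {i : 'I_n | i \in V}.

(* The point z with z_i = y_i for i in V and z_i = x_i otherwise; insub i is
   Some j with val j = i when i is in V, and None when it is not. *)
Definition glue (n : nat) (V : {set 'I_n}) (x : cube 'I_n)
    (y : cube (coords V)) : cube 'I_n :=
  [ffun i => if (insub i : option (coords V)) is Some j then y j else x i].

Definition restriction (n : nat) (f : cube 'I_n -> bool) (V : {set 'I_n})
    (x : cube 'I_n) : cube (coords V) -> bool :=
  fun y => f (glue x y).

Definition moment (R : realType) (n : nat) (V : {set 'I_n}) (eps : R)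
    (f : cube 'I_n -> bool) : R :=
  expectation (fun x : cube 'I_n =>
    \sum_(S : {set coords V})
      powR `|fourier (fun y => sgn_val R (restriction f x y)) S|
           (2 * (1 + eps))).

Definition flip (n : nat) (k : 'I_n) (x : cube 'I_n) : cube 'I_n :=
  [ffun i => if i == k then ~~ x i else x i].

Definition influence (R : realType) (n : nat) (k : 'I_n)
    (f : cube 'I_n -> bool) : R :=
  prob R [set x : cube 'I_n | f x != f (flip k x)].

(* Main.v *)
(* For x in the cube and S included in V1, let a and b be the coefficients at S
   of the restrictions of f to V1 around x and around x with k flipped.  Up to
   sign, u = (a + b) / 2 and v = (a - b) / 2 are the coefficients at S and
   S + {k} of the restriction to V2, so the difference of moments is the mean
   of the sum over S of |u|^p + |v|^p - (|u + v|^p + |u - v|^p) / 2 with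
   p = 2 (1 + eps).  Bernoulli's inequality t^a <= 1 + a (t - 1) bounds each
   term below by a linear function of u^2 and v^2, and Bessel's inequality
   bounds the sums of v^2 and of u^2 + v^2 by the influence I and by 1.  This
   yields 4 eps + I^-eps - 1 as the factor of -I; it is at most the announced
   one because 4^eps >= 1 + eps. *)

Require Import Defs.
From mathcomp Require Import all_boot all_order all_algebra.
From mathcomp Require Import reals exp.
From mathcomp Require Import ring lra.

Set Implicit Arguments.
Unset Strict Implicit.

Import Order.TTheory GRing.Theory Num.Theory.
Local Open Scope ring_scope.

(** * Scalar inequalities for real powers *)

Lemma powR_bernoulli (R : realType) (s a : R) :
  0 <= s -> 0 <= a <= 1 -> powR s a <= 1 + a * (s - 1).
Proof.
rewrite le_eqVlt => /orP[/eqP <-|s0] /andP[a0 a1].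
  by have [->|an0] := eqVneq a 0; rewrite ?powRr0 ?powR0 //; lra.
have -> : powR s a = sequences.expR (a * ln s).
  by rewrite /powR gt_eqF.
have Es : s = sequences.expR (ln s) by rewrite lnK // posrE.
set L := ln s in Es *; set e := sequences.expR (a * L).
have e0 : 0 < e by exact: expR_gt0.
(* Here [s] is the exponential of [L]. The bound [exp t >= 1 + t] is used at [(1 - a) * L] and at
   [- (a * L)]; the weights [a] and [1 - a] then cancel the terms in [L]. *)
have h1 : e * (1 + (1 - a) * L) <= s.
  rewrite Es (_ : L = a * L + (1 - a) * L) ?expRD; last by ring.
  rewrite -/e (_ : a * L + _ = L); last by ring.
  by rewrite ler_pM2l // expR_ge1Dx.
have h2 : e * (1 - a * L) <= 1.
  have := expR_ge1Dx (- (a * L)); rewrite expRN -/e -(ler_pM2l e0) divff //.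
  by rewrite gt_eqF.
have : a * (e * (1 + (1 - a) * L)) + (1 - a) * (e * (1 - a * L))
    <= a * s + (1 - a) * 1.
  by apply: lerD; apply: ler_wpM2l => //; lra.
rewrite (_ : a * _ + _ = e); last by ring.
by move=> h; apply: (le_trans h); lra.
Qed.

Lemma powR_le1 (R : realType) (x r : R) : 0 <= x <= 1 -> 0 <= r -> powR x r <= 1.
Proof.
move=> /andP[x0 x1] r0; have := ge0_ler_powR r0 x0 ler01 x1.
by rewrite /= powR1.
Qed.

Lemma powR_sqr (R : realType) (x e : R) :
  0 <= x -> powR (x ^+ 2) e = powR x (2 * e).
Proof. by move=> x0; rewrite powRrM powR_mulrn. Qed.

(** By homogeneity only [r = b / a] in [0, 1] matters. Bernoulli's inequality replaces the powers of
    [1 + r] and [1 - r] by [1 + d r] and [1 - d r], after which the odd powers of [r] cancel. *)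
Lemma two_point_upper (R : realType) (a b d : R) :
  0 <= b <= a -> 0 <= d <= 1 ->
  (a + b) ^+ 2 * powR (a + b) d + (a - b) ^+ 2 * powR (a - b) d <=
    2 * powR a d * (a ^+ 2 + (1 + 2 * d) * b ^+ 2).
Proof.
move=> /andP[b0 ba] d01.
have [a0|an0] := eqVneq a 0.
  have -> : b = 0 by apply/eqP; rewrite eq_le b0 -a0 ba.
  by rewrite a0 expr0n /= !(mulr0, mul0r, addr0, subr0) expr0n /= !mul0r addr0.
have a0 : 0 < a by rewrite lt_neqAle eq_sym an0 (le_trans b0 ba).
set r := b / a.
have rE : b = a * r by rewrite mulrC divfK.
have r0 : 0 <= r by rewrite divr_ge0 // ltW.
have r1 : r <= 1 by rewrite ler_pdivrMr // mul1r.
have -> : a + b = a * (1 + r) by rewrite {1}rE; ring.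
have -> : a - b = a * (1 - r) by rewrite {1}rE; ring.
rewrite !powRM ?(ltW a0) ?subr_ge0 ?addr_ge0 //.
have h1 : powR (1 + r) d <= 1 + d * r.
  by have := @powR_bernoulli _ (1 + r) d (addr_ge0 ler01 r0) d01; lra.
have h2 : powR (1 - r) d <= 1 - d * r.
  by have := @powR_bernoulli _ (1 - r) d; rewrite subr_ge0; lra.
set P := powR a d.
have -> : 2 * P * (a ^+ 2 + (1 + 2 * d) * b ^+ 2) =
  P * ((a * (1 + r)) ^+ 2 * (1 + d * r) + (a * (1 - r)) ^+ 2 * (1 - d * r)).
  by rewrite rE; ring.
rewrite (mulrDr P) !(mulrCA _ P).
by apply: lerD; apply: ler_wpM2l; rewrite ?powR_ge0 ?ler_wpM2l ?sqr_ge0.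
Qed.

(* The parameter J is to be the influence: weighting Bernoulli's inequality at
   J u^2 / v^2 linearizes the Hoelder step
   sum v^2 (u^2 / v^2)^eps <= (sum v^2)^(1 - eps) (sum u^2)^eps. *)
Lemma two_point_lower (R : realType) (u v e J : R) :
  0 <= u <= 1 -> 0 <= v <= 1 -> 0 <= e <= 1 / 2 -> 0 < J ->
  (1 - 4 * e) * v ^+ 2
    - powR J (- e) * ((1 - e) * v ^+ 2 + e * J * (u ^+ 2 + v ^+ 2)) <=
  u ^+ 2 * powR u (2 * e) + v ^+ 2 * powR v (2 * e)
  - ((u + v) ^+ 2 * powR (u + v) (2 * e)
     + `|u - v| ^+ 2 * powR `|u - v| (2 * e)) / 2.
Proof.
move=> /andP[u0 u1] /andP[v0 v1] /andP[e0 e1] J0.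
have PJ0 : 0 < powR J (- e) by exact: powR_gt0.
(* The general argument divides by [v]. For [v = 0] the right-hand side vanishes and the left one is
   nonpositive. *)
have [vz|vn0] := eqVneq v 0.
  rewrite vz expr0n /= !(mulr0, mul0r, addr0, subr0, add0r) ger0_norm //.
  have := sqr_ge0 u; set x := _ ^+ 2; set y := powR u _ => x0.
  suff : 0 <= powR J (- e) * (e * J * x) by lra.
  by rewrite !mulr_ge0 // ltW.
have vp : 0 < v by rewrite lt_neqAle eq_sym vn0.
have d01 : 0 <= 2 * e <= 1 by lra.
(* Bernoulli's inequality at J m^2 / v^2 *)
have key m : 0 <= m -> v ^+ 2 * powR (m / v) (2 * e) <=
    powR J (- e) * ((1 - e) * v ^+ 2 + e * J * m ^+ 2).
  move=> m0; have mv0 : 0 <= m / v by rewrite divr_ge0.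
  have := @powR_bernoulli _ (J * (m / v) ^+ 2) e.
  rewrite mulr_ge0 ?sqr_ge0 ?(ltW J0) // => /(_ isT) h.
  have {}h : powR (J * (m / v) ^+ 2) e <= 1 + e * (J * (m / v) ^+ 2 - 1).
    by apply: h; lra.
  move: h; rewrite powRM ?sqr_ge0 ?(ltW J0) // powR_sqr //.
  rewrite -(ler_pM2l PJ0) mulrA powRN mulVf ?gt_eqF ?powR_gt0 // mul1r.
  rewrite -(@ler_pM2l _ (v ^+ 2)) ?exprn_gt0 // => h.
  apply: (le_trans h); rewrite le_eqVlt; apply/orP; left; apply/eqP.
  by rewrite [LHS]mulrCA; congr (_ * _); field.
have sq0 : 0 <= powR J (- e) * (e * J).
  by rewrite !mulr_ge0 // ltW.
have u20 := sqr_ge0 u; have v20 := sqr_ge0 v.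
(* [two_point_upper] wants the larger number first. When [v <= u], the main loss is [v ^+ 2] times
   the gap between the powers of [u] and [v]; as the power of [v] is at most 1, [key] at [u] absorbs
   it. *)
case: (leP v u) => [vu|/ltW uv].
- rewrite ger0_norm ?subr_ge0 //.
  have := @two_point_upper _ u v (2 * e); rewrite v0 vu => /(_ isT d01) h.
  have hk := key u u0.
  have uE : powR u (2 * e) = powR v (2 * e) * powR (u / v) (2 * e).
    by rewrite -powRM ?divr_ge0 //; congr powR; field.
  have r1 : 1 <= powR (u / v) (2 * e).
    have := @ge0_ler_powR _ (2 * e) _ 1 (u / v).
    by rewrite powR1 /=; apply; rewrite ?nnegrE ?divr_ge0 ?ler_pdivlMr ?mul1r //; lra.
  have fv1 : powR v (2 * e) <= 1 by apply: powR_le1; lra.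
  have fu1 : powR u (2 * e) <= 1 by apply: powR_le1; lra.
  have k1 : v ^+ 2 * (powR u (2 * e) - powR v (2 * e)) <=
      v ^+ 2 * (powR (u / v) (2 * e) - 1).
    apply: ler_wpM2l => //; rewrite uE.
    have := @mulr_ge0 _ (1 - powR v (2 * e)) (powR (u / v) (2 * e) - 1).
    by rewrite !subr_ge0 => /(_ fv1 r1); lra.
  have k2 : 4 * e * (v ^+ 2 * powR u (2 * e)) <= 4 * e * v ^+ 2.
    by apply: ler_wpM2l; [lra|rewrite ler_piMr].
  have k3 : 0 <= powR J (- e) * (e * J) * v ^+ 2 by rewrite mulr_ge0.
  lra.
- rewrite distrC ger0_norm ?subr_ge0 // (addrC u v).
  have := @two_point_upper _ v u (2 * e); rewrite u0 uv => /(_ isT d01) h.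
  (* [key] at [v] makes the left-hand side at most [- 4 e v^2]. It then suffices to bound the loss
     by [e (v^2 - u^2) + 4 e u^2]. *)
  have hk := key v v0; rewrite divff // powR1 mulr1 in hk.
  have k3 : 0 <= powR J (- e) * (e * J) * u ^+ 2 by rewrite mulr_ge0.
  have fv1 : powR v (2 * e) <= 1 by apply: powR_le1; lra.
  have fv0 : 0 <= powR v (2 * e) by exact: powR_ge0.
  have u2v : u ^+ 2 <= v ^+ 2 by rewrite ler_sqr.
  (* Bernoulli's inequality at v^2 / u^2 *)
  have k1 : u ^+ 2 * (powR v (2 * e) - powR u (2 * e)) <= e * (v ^+ 2 - u ^+ 2).
    have [uz|un0] := eqVneq u 0.
      by rewrite uz expr0n /= mul0r subr0 mulr_ge0 //.
    have up : 0 < u by rewrite lt_neqAle eq_sym un0.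
    have fu1 : powR u (2 * e) <= 1 by apply: powR_le1; lra.
    have fu0 : 0 <= powR u (2 * e) by exact: powR_ge0.
    have := @powR_bernoulli _ ((v / u) ^+ 2) e; rewrite sqr_ge0 => /(_ isT).
    rewrite powR_sqr ?divr_ge0 // => b.
    have {}b : powR (v / u) (2 * e) <= 1 + e * ((v / u) ^+ 2 - 1) by apply: b; lra.
    have vE : powR v (2 * e) = powR u (2 * e) * powR (v / u) (2 * e).
      by rewrite -powRM ?divr_ge0 //; congr powR; field.
    have : powR u (2 * e) * (u ^+ 2 * (powR (v / u) (2 * e) - 1)) <=
       powR u (2 * e) * (e * (v ^+ 2 - u ^+ 2)).
      apply: ler_wpM2l => //.
      rewrite (_ : e * (v ^+ 2 - u ^+ 2) = u ^+ 2 * (e * ((v / u) ^+ 2 - 1))).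
        by apply: ler_wpM2l => //; lra.
      by field.
    have : powR u (2 * e) * (e * (v ^+ 2 - u ^+ 2)) <= e * (v ^+ 2 - u ^+ 2).
      by apply: ler_piMl => //; rewrite mulr_ge0 // subr_ge0.
    rewrite vE; lra.
  have k2 : 4 * e * (u ^+ 2 * powR v (2 * e)) <= 4 * e * u ^+ 2.
    by apply: ler_wpM2l; [lra|rewrite ler_piMr].
  have k4 : 0 <= e * (v ^+ 2 - u ^+ 2) by rewrite mulr_ge0 // subr_ge0.
  have k5 : powR v (2 * e) * v ^+ 2 <= v ^+ 2 by rewrite ler_piMl.
  lra.
Qed.

(** * Means over finite sets and over the cube *)

Lemma expectation_le (R : realType) (X : finType) (g h : X -> R) :
  (forall x, g x <= h x) -> expectation g <= expectation h.
Proof. by move=> gh; rewrite ler_wpM2r ?invr_ge0 ?ler0n // ler_sum. Qed.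

Lemma eq_expectation (R : realType) (X : finType) (g h : X -> R) :
  g =1 h -> expectation g = expectation h.
Proof. by move=> gh; rewrite /expectation (eq_bigr h). Qed.

Lemma expectationD (R : realType) (X : finType) (g h : X -> R) :
  expectation (fun x => g x + h x) = expectation g + expectation h.
Proof. by rewrite /expectation big_split mulrDl. Qed.

Lemma expectationZ (R : realType) (X : finType) (c : R) (g : X -> R) :
  expectation (fun x => c * g x) = c * expectation g.
Proof. by rewrite /expectation -mulr_sumr mulrA. Qed.

Lemma expectationB (R : realType) (X : finType) (g h : X -> R) :
  expectation (fun x => g x - h x) = expectation g - expectation h.
Proof. by rewrite /expectation sumrB mulrBl. Qed.

Lemma expectation_cst (R : realType) (X : finType) (c : R) :
  (0 < #|X|)%N -> expectation (fun _ : X => c) = c.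
Proof.
move=> X0; rewrite /expectation sumr_const -[c *+ _]mulr_natr mulfK //.
by rewrite pnatr_eq0 -lt0n.
Qed.

Lemma expectation_sum (R : realType) (X I : finType) (P : pred I)
    (g : I -> X -> R) :
  expectation (fun x => \sum_(i | P i) g i x) =
  \sum_(i | P i) expectation (g i).
Proof. by rewrite /expectation exchange_big mulr_suml. Qed.

Lemma card_cube_gt0 (T : finType) : (0 < #|cube T|)%N.
Proof. by rewrite card_ffun card_bool expn_gt0. Qed.

Lemma card_cube_neq0 (R : realType) (T : finType) : #|cube T|%:R != 0 :> R.
Proof. by rewrite pnatr_eq0 -lt0n card_cube_gt0. Qed.

Lemma flipK (n : nat) (k : 'I_n) : involutive (@flip n k).
Proof.
by move=> x; apply/ffunP=> i; rewrite !ffunE; case: eqP => // _; rewrite negbK.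
Qed.

Lemma expectation_flip (R : realType) (n : nat) (k : 'I_n)
    (g : cube 'I_n -> R) :
  expectation (fun x => g (flip k x)) = expectation g.
Proof. by rewrite /expectation [in RHS](reindex_inj (inv_inj (@flipK n k))). Qed.

(** * Fourier coefficients of restrictions, carried to the whole cube *)

Definition character (R : realType) (T : finType) (S : {set T}) (z : cube T) : R :=
  \prod_(i in S) sgn_val R (z i).

Definition mix (n : nat) (V : {set 'I_n}) (x z : cube 'I_n) : cube 'I_n :=
  [ffun i => if i \in V then z i else x i].

(* Fourier coefficient at S of the restriction of f to V, computed on the whole
   cube so that its type does not depend on V (see fourier_restriction). *)
Definition mixed_coef (R : realType) (n : nat) (V : {set 'I_n})
    (f : cube 'I_n -> bool) (x : cube 'I_n) (S : {set 'I_n}) : R :=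
  expectation (fun z => sgn_val R (f (mix V x z)) * character R S z).

Lemma mixK (n : nat) (V : {set 'I_n}) (x z : cube 'I_n) :
  mix V (mix V x z) (mix V z x) = x.
Proof. by apply/ffunP=> i; rewrite !ffunE; case: (i \in V). Qed.

(** Exchanging the coordinates in [V] between [x] and [z] is an involution on pairs, so [mix V x z]
    is uniform when [x] and [z] are independent and uniform. *)
Lemma expectation_mix (R : realType) (n : nat) (V : {set 'I_n})
    (g : cube 'I_n -> R) :
  expectation (fun x => expectation (fun z => g (mix V x z))) = expectation g.
Proof.
rewrite /expectation -mulr_suml; congr (_ / _).
rewrite pair_bigA /=.
have h : involutive (fun p : cube 'I_n * cube 'I_n =>
                       (mix V p.1 p.2, mix V p.2 p.1)).
  by move=> [x z] /=; rewrite !mixK.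
rewrite (reindex_inj (inv_inj h)) /=.
under eq_bigr do rewrite mixK.
rewrite -(pair_bigA _ (fun x _ => g x)) /=.
under eq_bigr do rewrite sumr_const -[g _ *+ _]mulr_natr.
by rewrite -mulr_suml mulfK // card_cube_neq0.
Qed.

Definition restrict (n : nat) (V : {set 'I_n}) (z : cube 'I_n) : cube (coords V) :=
  [ffun j => z (val j)].

Lemma restrict_glue (n : nat) (V : {set 'I_n}) (x : cube 'I_n)
    (y : cube (coords V)) : restrict V (glue x y) = y.
Proof. by apply/ffunP=> j; rewrite !ffunE valK. Qed.

Lemma glue_restrict (n : nat) (V : {set 'I_n}) (x z : cube 'I_n) :
  glue x (restrict V z) = mix V x z.
Proof.
apply/ffunP=> i; rewrite !ffunE; case: insubP => [j iV ji|/negbTE ->//].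
by rewrite iV ffunE ji.
Qed.

(** Exchanging [y] with the [V]-coordinates of [z] is an involution of the product, which avoids
    counting the fibres of [restrict]. *)
Lemma expectation_restrict (R : realType) (n : nat) (V : {set 'I_n})
    (g : cube (coords V) -> R) :
  expectation (fun z => g (restrict V z)) = expectation g.
Proof.
have h : involutive (fun p : cube (coords V) * cube 'I_n =>
                       (restrict V p.2, glue p.2 p.1)).
  move=> [y z] /=; rewrite restrict_glue glue_restrict; congr (_, _).
  apply/ffunP=> i; rewrite !ffunE; case: ifP => // iV.
  by rewrite insubF.
have : \sum_(y : cube (coords V)) \sum_(z : cube 'I_n) g y =
       \sum_(y : cube (coords V)) \sum_(z : cube 'I_n) g (restrict V z).
  by rewrite !pair_bigA /= (reindex_inj (inv_inj h)).
rewrite exchange_big /= !sumr_const => E.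
apply/eqP; rewrite eqr_div ?card_cube_neq0 // !mulr_natr.
by apply/eqP; exact: esym E.
Qed.

Lemma fourier_restriction (R : realType) (n : nat) (V : {set 'I_n})
    (f : cube 'I_n -> bool) (x : cube 'I_n) (S : {set coords V}) :
  fourier (fun y => sgn_val R (restriction f x y)) S =
  mixed_coef R V f x (val @: S).
Proof.
rewrite /fourier mulrC (_ : 2 ^- _ = #|cube (coords V)|%:R^-1); last first.
  by rewrite card_ffun card_bool natrX.
rewrite -/(expectation _) -expectation_restrict; apply: eq_expectation => z.
rewrite /restriction glue_restrict /character big_imset; last first.
  by move=> ? ? _ _; exact: val_inj.
by congr (_ * _); apply: eq_bigr => j _; rewrite ffunE.
Qed.

Lemma moment_mixed_coef (R : realType) (n : nat) (V : {set 'I_n}) (eps : R)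
    (f : cube 'I_n -> bool) :
  moment V eps f =
  expectation (fun x => \sum_(S : {set 'I_n} | S \subset V)
    powR `|mixed_coef R V f x S| (2 * (1 + eps))).
Proof.
apply: eq_expectation => x.
rewrite [RHS](reindex_onto (fun S : {set coords V} => val @: S)
  (fun S => [set j | val j \in S])) /=; last first.
  move=> S SV; apply/setP=> i; apply/imsetP/idP => [[j]|iS].
    by rewrite inE => jS ->.
  by exists (Sub i (subsetP SV i iS)); rewrite ?inE SubK.
apply: eq_big => [S|S _]; last by rewrite fourier_restriction.
apply/esym/andP; split.
  by apply/subsetP=> i /imsetP[j _ ->]; exact: valP.
by apply/eqP/setP=> j; rewrite inE mem_imset //; exact: val_inj.
Qed.

Lemma sum_subsetU1 (R : realType) (T : finType) (V : {set T}) (k : T)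
    (G : {set T} -> R) : k \notin V ->
  \sum_(S : {set T} | S \subset k |: V) G S =
  \sum_(S : {set T} | S \subset V) (G S + G (k |: S)).
Proof.
move=> kV; rewrite big_split (bigID (fun S : {set T} => k \in S)) /= addrC.
congr (_ + _).
  by apply: eq_bigl => S; rewrite -subsetD1 setU1K.
rewrite (reindex_onto (fun S : {set T} => k |: S) (fun S => S :\ k)) /=; last first.
  by move=> S /andP[_ kS]; rewrite setD1K.
apply: eq_bigl => S; rewrite setU11 andbT.
apply/andP/idP => [[SV /eqP <-]|SV].
  by rewrite -(setU1K kV) setSD.
by rewrite setUS // setU1K //; apply: contra kV; apply: (subsetP SV).
Qed.

(** * Orthogonality of characters, Parseval and Bessel *)

Lemma sum_character_mul (R : realType) (T : finType) (z w : cube T) :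
  \sum_(S : {set T}) character R S z * character R S w =
  if z == w then #|cube T|%:R else 0.
Proof.
(* Expanding this product over [T] gives one term per subset [S]; a coordinate where [z] and [w]
   differ yields a factor [-1 + 1]. *)
have -> : \sum_(S : {set T}) character R S z * character R S w =
    \prod_(i : T) (sgn_val R (z i) * sgn_val R (w i) + 1).
  rewrite bigA_distr; apply: eq_bigr => S _.
  by rewrite -big_split /= [LHS]big_mkcond.
have [->|zw] := eqVneq z w.
  rewrite card_ffun card_bool natrX -prodr_const.
  by apply: eq_bigr => i _; rewrite -expr2 /sgn_val sqrr_sign.
have [i zwi] : exists i, z i != w i.
  apply/existsP; apply: contraR zw; rewrite negb_exists => /forallP h.
  by apply/eqP/ffunP=> i; apply/eqP; rewrite -[_ == _]negbK h.
rewrite (bigD1 i) //= (_ : _ + 1 = 0) ?mul0r //.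
by move: zwi; rewrite /sgn_val; case: (z i); case: (w i) => //= _; ring.
Qed.

Lemma parseval (R : realType) (T : finType) (g : cube T -> R) :
  \sum_(S : {set T}) expectation (fun z => g z * character R S z) ^+ 2 =
  expectation (fun z => g z ^+ 2).
Proof.
set N : R := #|cube T|%:R; have N0 : N != 0 by exact: card_cube_neq0.
transitivity (\sum_(S : {set T}) \sum_(z : cube T) \sum_(w : cube T)
    g z * g w / N ^+ 2 * (character R S z * character R S w)).
  apply: eq_bigr => S _; rewrite /expectation -/N expr2 mulrACA.
  rewrite big_distrlr /= mulr_suml; apply: eq_bigr => z _.
  by rewrite mulr_suml; apply: eq_bigr => w _; rewrite -exprVn; ring.
rewrite exchange_big /= /expectation mulr_suml; apply: eq_bigr => z _.
rewrite exchange_big /= (bigD1 z) //= -mulr_sumr sum_character_mul eqxx.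
rewrite big1 ?addr0; first by rewrite -/N; field.
by move=> w /negbTE wz; rewrite -mulr_sumr sum_character_mul eq_sym wz mulr0.
Qed.

Lemma bessel (R : realType) (T : finType) (P : pred {set T}) (g : cube T -> R) :
  \sum_(S : {set T} | P S) expectation (fun z => g z * character R S z) ^+ 2 <=
  expectation (fun z => g z ^+ 2).
Proof.
rewrite -parseval [leRHS](bigID P) /= lerDl sumr_ge0 // => S _.
exact: sqr_ge0.
Qed.

(** * Effect of freeing one more coordinate [k] *)

Lemma mix_flip (n : nat) (V : {set 'I_n}) (k : 'I_n) (x z : cube 'I_n) :
  k \notin V -> mix V (flip k x) z = flip k (mix V x z).
Proof.
move=> kV; apply/ffunP=> i; rewrite !ffunE; case: eqP => [->|_].
  by rewrite (negbTE kV).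
by case: (i \in V).
Qed.

Lemma mix_flipr (n : nat) (V : {set 'I_n}) (k : 'I_n) (x z : cube 'I_n) :
  k \notin V -> mix V x (flip k z) = mix V x z.
Proof.
move=> kV; apply/ffunP=> i; rewrite !ffunE; case: (i =P k) => // ->.
by rewrite (negbTE kV).
Qed.

Lemma mix_setU1 (n : nat) (V : {set 'I_n}) (k : 'I_n) (x z : cube 'I_n) :
  k \notin V ->
  mix (k |: V) x z = if z k == x k then mix V x z else mix V (flip k x) z.
Proof.
move=> kV; case: ifPn => zx; apply/ffunP=> i; rewrite !ffunE !inE;
  have [->|_] //= := eqVneq i k; rewrite (negbTE kV); first exact/eqP.
by move: zx; case: (z k); case: (x k).
Qed.

Lemma character_flip (R : realType) (n : nat) (S : {set 'I_n}) (k : 'I_n)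
    (z : cube 'I_n) :
  k \notin S -> character R S (flip k z) = character R S z.
Proof.
move=> kS; apply: eq_bigr => i iS; rewrite ffunE; case: eqP => // ik.
by rewrite -ik iS in kS.
Qed.

Lemma character_setU1 (R : realType) (n : nat) (S : {set 'I_n}) (k : 'I_n)
    (z : cube 'I_n) :
  k \notin S -> character R (k |: S) z = sgn_val R (z k) * character R S z.
Proof. by move=> kS; rewrite /character big_setU1. Qed.

(** Pair [z] with [flip k z]: exactly one of them agrees with [x] at [k], and the other one sees [x]
    with [k] flipped. *)
Lemma mixed_coef_setU1l (R : realType) (n : nat) (V S : {set 'I_n}) (k : 'I_n)
    (f : cube 'I_n -> bool) (x : cube 'I_n) :
  k \notin V -> k \notin S ->
  mixed_coef R (k |: V) f x S =
  2^-1 * (mixed_coef R V f x S + mixed_coef R V f (flip k x) S).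
Proof.
move=> kV kS; rewrite /mixed_coef; set g := fun z => _.
transitivity (2^-1 * (expectation g + expectation (fun z => g (flip k z)))).
  by rewrite expectation_flip; field.
rewrite -!expectationD; congr (_ * _); apply: eq_expectation => z.
rewrite /g character_flip // !mix_setU1 // [flip k z k]ffunE eqxx !mix_flipr //.
by case: (z k); case: (x k) => /=; ring.
Qed.

(** Same pairing, but now the character takes opposite signs at [z] and [flip k z], so a difference
    appears. *)
Lemma mixed_coef_setU1r (R : realType) (n : nat) (V S : {set 'I_n}) (k : 'I_n)
    (f : cube 'I_n -> bool) (x : cube 'I_n) :
  k \notin V -> k \notin S ->
  mixed_coef R (k |: V) f x (k |: S) =
  2^-1 * (sgn_val R (x k) *
          (mixed_coef R V f x S - mixed_coef R V f (flip k x) S)).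
Proof.
move=> kV kS; rewrite {1}/mixed_coef; set g := fun z => _.
transitivity (2^-1 * (expectation g + expectation (fun z => g (flip k z)))).
  by rewrite expectation_flip; field.
rewrite /mixed_coef -expectationB -expectationZ -expectationD; congr (_ * _).
apply: eq_expectation => z.
rewrite /g !character_setU1 // character_flip // !mix_setU1 //.
rewrite [flip k z k]ffunE eqxx !mix_flipr //.
by rewrite /sgn_val; case: (z k); case: (x k) => /=; ring.
Qed.

Lemma mixed_coef_norm_le1 (R : realType) (n : nat) (V S : {set 'I_n})
    (f : cube 'I_n -> bool) (x : cube 'I_n) :
  `|mixed_coef R V f x S| <= 1.
Proof.
rewrite -(@ler_sqr _ _ 1) ?nnegrE // expr1n real_normK ?num_real //.
have := bessel (pred1 S) (fun z => sgn_val R (f (mix V x z))).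
rewrite big_pred1_eq => /le_trans; apply; rewrite le_eqVlt.
rewrite (@eq_expectation _ _ _ (fun _ => 1)) ?expectation_cst ?eqxx //.
  exact: card_cube_gt0.
by move=> z; rewrite sqrr_sign.
Qed.

Lemma sum_mixed_coef_sqr_le1 (R : realType) (n : nat) (V : {set 'I_n})
    (f : cube 'I_n -> bool) (x : cube 'I_n) (P : pred {set 'I_n}) :
  \sum_(S : {set 'I_n} | P S) mixed_coef R V f x S ^+ 2 <= 1.
Proof.
apply: (le_trans (bessel P (fun z => sgn_val R (f (mix V x z))))).
rewrite (@eq_expectation _ _ _ (fun _ => 1)) ?expectation_cst //.
  exact: card_cube_gt0.
by move=> z; rewrite sqrr_sign.
Qed.

(** * Influence and the discrete derivative *)

Lemma influenceE (R : realType) (n : nat) (k : 'I_n) (f : cube 'I_n -> bool) :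
  influence R k f =
  expectation (fun x => (2^-1 * (sgn_val R (f x) - sgn_val R (f (flip k x)))) ^+ 2).
Proof.
rewrite /influence /prob -sum1_card natr_sum big_mkcond; congr (_ / _).
apply: eq_bigr => x _; rewrite inE /sgn_val.
by case: (f x); case: (f (flip k x)) => /=; field.
Qed.

Lemma influence_ge0 (R : realType) (n : nat) (k : 'I_n) (f : cube 'I_n -> bool) :
  0 <= influence R k f.
Proof. by rewrite divr_ge0. Qed.

Lemma influence_le1 (R : realType) (n : nat) (k : 'I_n) (f : cube 'I_n -> bool) :
  influence R k f <= 1.
Proof.
rewrite ler_pdivrMr ?ltr0n ?card_cube_gt0 // mul1r ler_nat.
exact: max_card.
Qed.

Lemma influence_eq0 (R : realType) (n : nat) (k : 'I_n) (f : cube 'I_n -> bool)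
    (x : cube 'I_n) :
  influence R k f = 0 -> f (flip k x) = f x.
Proof.
move/eqP; rewrite mulf_eq0 invr_eq0 (negbTE (card_cube_neq0 _ _)) orbF.
rewrite pnatr_eq0 cards_eq0 => /eqP/setP/(_ x).
by rewrite !inE => /negbFE/eqP.
Qed.

(** Up to sign, these are coefficients of restrictions of the derivative [(f(x) - f(flip k x)) / 2],
    whose mean square is the influence. Bessel applies around each [x], and [expectation_mix]
    averages the result. *)
Lemma sum_derivative_sqr_le (R : realType) (n : nat) (V : {set 'I_n}) (k : 'I_n)
    (f : cube 'I_n -> bool) : k \notin V ->
  expectation (fun x => \sum_(S : {set 'I_n} | S \subset V)
    mixed_coef R (k |: V) f x (k |: S) ^+ 2) <= influence R k f.
Proof.
move=> kV; rewrite influenceE -[leRHS](expectation_mix V); apply: expectation_le => x.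
set g := fun z => 2^-1 * (sgn_val R (f (mix V x z)) -
                          sgn_val R (f (flip k (mix V x z)))).
apply: (le_trans _ (bessel (fun S : {set 'I_n} => S \subset V) g)).
apply: ler_sum => S SV.
have kS : k \notin S by apply: contra kV; exact: (subsetP SV).
rewrite mixed_coef_setU1r // mulrCA exprMn /sgn_val sqrr_sign mul1r.
rewrite /mixed_coef -expectationB -expectationZ.
rewrite le_eqVlt; apply/orP; left; apply/eqP; congr (_ ^+ 2).
by apply: eq_expectation => z; rewrite mix_flip // /g /sgn_val; ring.
Qed.

(** * Passage to absolute values and conclusion *)

Lemma powR_norm_expand (R : realType) (x e : R) : 0 < e ->
  powR `|x| (2 * (1 + e)) = x ^+ 2 * powR `|x| (2 * e).
Proof.
move=> e0; rewrite mulrDr mulr1 powRD; last by apply/implyP => /eqP; lra.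
by rewrite powR_mulrn // real_normK ?num_real.
Qed.

(** Up to signs and order, the two arguments on each side are the same. This reduces signed
    coefficients to the nonnegative numbers that [two_point_lower] requires. *)
Lemma parallelogram_norm (R : realDomainType) (F : R -> R) (u v : R) :
  (forall y, F (- y) = F y) ->
  F (u + v) + F (u - v) = F (`|u| + `|v|) + F `| `|u| - `|v| |.
Proof.
move=> FN; have FA y : F `|y| = F y by case: ger0P.
rewrite FA; case: (ger0P u) => _; case: (ger0P v) => _ //.
- by rewrite opprK addrC.
- by rewrite -[F (u + v)]FN -[F (u - v)]FN !opprD opprK addrC.
- by rewrite -[F (u + v)]FN -[F (u - v)]FN !opprD opprK.
Qed.

(* When the influence is 0, the product on the right-hand side is 0 because
   powR is total; this agrees with reading I_k (I_k / 4)^(-eps) as 0. *)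
Theorem theorem5p2p1 (R : realType) (n : nat) (f : cube 'I_n -> bool)
    (V1 : {set 'I_n}) (k : 'I_n) (eps : R)
    (hk : k \notin V1) (heps0 : 0 < eps) (heps1 : eps < 1 / 2) :
  let V2 := k |: V1 in
  let I := influence R k f in
  moment V2 eps f - moment V1 eps f >=
    - I * (3 * eps + 2 * eps ^+ 2 + powR (I / 4) (- eps) - 1).
Proof.
cbv zeta; set V2 := k |: V1; set I := influence R k f.
pose F (y : R) := y ^+ 2 * powR `|y| (2 * eps).
pose u x (S : {set 'I_n}) := mixed_coef R V2 f x S.
pose v x (S : {set 'I_n}) := mixed_coef R V2 f x (k |: S).
have FN y : F (- y) = F y by rewrite /F normrN sqrrN.
have FE y : powR `|y| (2 * (1 + eps)) = F y by rewrite powR_norm_expand.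
(* The sign carried by [v] only decides which of the two summands is which. *)
have split_coef x (S : {set 'I_n}) : S \subset V1 ->
    F (mixed_coef R V1 f x S) + F (mixed_coef R V1 f (flip k x) S) =
    F (u x S + v x S) + F (u x S - v x S).
  move=> SV; have kS : k \notin S by apply: contra hk; exact: (subsetP SV).
  rewrite /u /v mixed_coef_setU1l // mixed_coef_setU1r //.
  set a := mixed_coef _ _ _ x S; set b := mixed_coef _ _ _ _ S.
  rewrite /sgn_val; case: (x k) => /=.
  - by rewrite addrC; congr (F _ + F _); field.
  - by congr (F _ + F _); field.
have mE : moment V2 eps f - moment V1 eps f =
    expectation (fun x => \sum_(S : {set 'I_n} | S \subset V1)
      (F (u x S) + F (v x S) - (F (u x S + v x S) + F (u x S - v x S)) / 2)).
  have -> : moment V1 eps f = expectation (fun x =>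
      \sum_(S : {set 'I_n} | S \subset V1)
        (F (u x S + v x S) + F (u x S - v x S)) / 2).
    rewrite moment_mixed_coef; set g := fun x : cube 'I_n => _.
    (* The uniform law is invariant under [flip k], so the two restrictions can be averaged. *)
    transitivity (2^-1 * (expectation g + expectation (fun x => g (flip k x)))).
      by rewrite expectation_flip; field.
    rewrite -expectationD -expectationZ; apply: eq_expectation => x.
    rewrite /g -big_split mulr_sumr; apply: eq_bigr => S SV /=.
    by rewrite !FE -split_coef // mulrC.
  rewrite moment_mixed_coef -expectationB; apply: eq_expectation => x.
  rewrite sum_subsetU1 // -sumrB; apply: eq_bigr => S _.
  by rewrite !FE.
have I0 : 0 <= I by exact: influence_ge0.
have I1 : I <= 1 by exact: influence_le1.
(* [two_point_lower] needs a positive parameter. If [I = 0], every [v x S] is 0 and each summand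
   vanishes. *)
rewrite mE; have [Iz|In0] := eqVneq I 0.
  rewrite Iz oppr0 mul0r; apply: divr_ge0 => //; apply: sumr_ge0 => x _.
  apply: sumr_ge0 => S SV.
  have kS : k \notin S by apply: contra hk; exact: (subsetP SV).
  have -> : v x S = 0.
    rewrite /v mixed_coef_setU1r // (_ : _ - _ = 0) ?mulr0 //.
    apply/eqP; rewrite subr_eq0; apply/eqP/eq_expectation => z.
    by rewrite mix_flip // (influence_eq0 _ Iz).
  rewrite addr0 subr0 /F expr0n /= mul0r addr0 -/(F (u x S)); lra.
have Ip : 0 < I by rewrite lt_neqAle eq_sym In0.
set W := powR I (- eps).
set A := expectation (fun x => \sum_(S : {set 'I_n} | S \subset V1) v x S ^+ 2).
set B := expectation (fun x => \sum_(S : {set 'I_n} | S \subset V1)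
                                 (u x S ^+ 2 + v x S ^+ 2)).
have AI : A <= I by exact: sum_derivative_sqr_le.
have B1 : B <= 1.
  rewrite -(expectation_cst 1 (card_cube_gt0 'I_n)); apply: expectation_le => x.
  rewrite -(@sum_subsetU1 _ _ _ k (fun S => mixed_coef R V2 f x S ^+ 2)) //.
  exact: sum_mixed_coef_sqr_le1.
have lower : ((1 - 4 * eps) - W * (1 - eps)) * A - W * (eps * I) * B <=
    expectation (fun x => \sum_(S : {set 'I_n} | S \subset V1)
      (F (u x S) + F (v x S) - (F (u x S + v x S) + F (u x S - v x S)) / 2)).
  rewrite -!expectationZ -expectationB; apply: expectation_le => x.
  rewrite !mulr_sumr -sumrB; apply: ler_sum => S SV.
  rewrite (parallelogram_norm _ _ FN).
  have := @two_point_lower R `|u x S| `|v x S| eps I.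
  rewrite !normr_ge0 !mixed_coef_norm_le1 => /(_ isT isT).
  have e12 : 0 <= eps <= 1 / 2 by lra.
  move=> /(_ e12 Ip); rewrite -/W !real_normK ?num_real //.
  rewrite /F !normr_id !real_normK ?num_real //.
  rewrite (ger0_norm (addr_ge0 (normr_ge0 (u x S)) (normr_ge0 (v x S)))).
  by apply: le_trans; lra.
have W0 : 0 < W by exact: powR_gt0.
have W1 : 1 <= W.
  rewrite /W powRN -[1]invr1 lef_pV2 ?posrE ?powR_gt0 //.
  by apply: powR_le1; rewrite ?I0 ?I1 ?(ltW heps0).
have W4 : W * (1 + eps) <= powR (I / 4) (- eps).
  rewrite powRM ?invr_ge0 // -/W ler_pM2l //.
  set q := powR 4^-1 eps.
  have q0 : 0 < q by rewrite powR_gt0 // invr_gt0.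
  (* Writing 1/4 as a square matters: Bernoulli at 1/2 with exponent [2 * eps] gives [1 - eps],
     whereas at 1/4 it gives only [1 - 3/4 eps], too weak for small [eps]. *)
  have q1 : q <= 1 - eps.
    rewrite /q (_ : 4^-1 = 2^-1 ^+ 2); last by field.
    rewrite powR_sqr ?invr_ge0 //.
    have := @powR_bernoulli R 2^-1 (2 * eps).
    by rewrite invr_ge0 ler0n => /(_ isT) h; apply: (le_trans (h _)); lra.
  rewrite powRN -/q -(@ler_pM2r _ q) // mulVf ?gt_eqF //.
  apply: (@le_trans _ _ ((1 + eps) * (1 - eps))); last by nra.
  by rewrite ler_pM2l //; lra.
apply: le_trans lower.
(* Since [W >= 1], the coefficient is at most [- 3 eps], so [A <= I] reverses under it. *)
have cA : ((1 - 4 * eps) - W * (1 - eps)) * I <=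
          ((1 - 4 * eps) - W * (1 - eps)) * A.
  rewrite ler_wnM2l //.
  have : 1 * (1 - eps) <= W * (1 - eps) by apply: ler_wpM2r => //; lra.
  lra.
have cB : W * (eps * I) * B <= W * (eps * I).
  by apply: ler_piMr => //; exact: mulr_ge0 (ltW W0) (mulr_ge0 (ltW heps0) I0).
(* The bound reached so far is [- I (4 eps + W - 1)]. With [W (1 + eps)] in place of the power of
   [I / 4], the target's factor exceeds this one by [eps (W - 1) + 2 eps^2], which is
   nonnegative. *)
have c4 : I * (W * (1 + eps)) <= I * powR (I / 4) (- eps) by rewrite ler_wpM2l.
have c5 : 0 <= I * eps * (W - 1).
  by apply: mulr_ge0; [exact: mulr_ge0 I0 (ltW heps0)|rewrite subr_ge0].
have c6 : 0 <= I * eps ^+ 2 by exact: mulr_ge0 I0 (sqr_ge0 eps).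
lra.
Qed.
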